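(* Let $\Omega \subset \mathbb{R}^d$ be a bounded domain with smooth boundary, let $A \in C^1(\mathbb{R}^d, \mathbb{R}^d)$, let $V \in C^1(\mathbb{R}^d, \mathbb{R}_{\geq 0})$, and let $\phi \not\equiv 0$ be an eigenfunction with eigenvalue $\lambda$, that is, a solution of $$\frac{1}{2}\left(-i\nabla - A(x)\right)^2 \phi(x) + V(x)\phi(x) = \lambda \phi(x) \quad \text{in } \Omega$$ subject to Dirichlet boundary conditions $\phi = 0$ on $\partial\Omega$. Let $u:\Omega\to\mathbb{R}$ be the landscape function, i.e. the solution of $\left[-\frac12\Delta + V\right]u = 1$ in $\Omega$ with $u = 0$ on $\partial\Omega$. Then, for all $x \in \Omega$, $$\frac{|\phi(x)|}{\|\phi\|_{L^\infty(\Omega)}} \leq \lambda \cdot u(x).$$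
   Context: The operator $\frac12(-i\nabla - A)^2 + V$ with Dirichlet boundary conditions is the (self-adjoint) magnetic Schrödinger operator on $\Omega$; its eigenvalues $\lambda$ are real, and eigenfunctions $\phi$ are complex-valued. The landscape function $u$ does not involve $A$. *)

(* Defs.v *)
(* R^d is the space 'rV[R]_d of row vectors over an abstract R : realType, and
   C is R[i]. *)
From HB Require Import structures.
From mathcomp Require Import all_boot all_order all_algebra.
From mathcomp Require Import all_classical all_reals all_analysis.
From mathcomp Require Export complex.

Set Implicit Arguments.
Unset Strict Implicit.
Unset Printing Implicit Defensive.

Import Order.TTheory GRing.Theory Num.Theory.
Import numFieldNormedType.Exports.

Local Open Scope classical_set_scope.
Local Open Scope ring_scope.

Section Defs.
Context {R : realType} {d : nat}.

Implicit Types (Omega U N : set 'rV[R]_d) (f V u rho : 'rV[R]_d -> R)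
  (phi g : 'rV[R]_d -> R[i]) (A : 'rV[R]_d -> 'rV[R]_d) (x p : 'rV[R]_d)
  (j : 'I_d).

Definition basis_vec j : 'rV[R]_d := delta_mx 0 j.

Definition partial j f : 'rV[R]_d -> R := fun x => 'D_(basis_vec j) f x.

Definition iter_partial (s : seq 'I_d) f : 'rV[R]_d -> R := foldr partial f s.

(* f is C^k on the open set U: all iterated partial derivatives of order at
   most k exist and are continuous on U. *)
Definition Ck (k : nat) U f : Prop :=
  forall s : seq 'I_d, (size s <= k)%N ->
    (forall x, U x -> {for x, continuous (iter_partial s f)}) /\
    ((size s < k)%N ->
      forall j x, U x -> derivable (iter_partial s f) x (basis_vec j)).

Definition Csmooth U f : Prop := forall k : nat, Ck k U f.

Definition C1_field A : Prop := forall j, Ck 1 setT (fun x => A x 0 j).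

(* Topological boundary; for the open sets considered below this is
   closure Omega `\` Omega. *)
Definition frontier Omega : set 'rV[R]_d := closure Omega `\` Omega°.

(* Near each of its boundary points, Omega is the sublevel set {rho < 0} of a
   C^oo function rho whose gradient does not vanish at that point (rho p = 0
   follows from p being on the boundary of the open set Omega). *)
Definition smooth_boundary Omega : Prop :=
  forall p, frontier Omega p ->
    exists U rho,
      [/\ open U, U p, Csmooth U rho,
          (exists j, partial j rho p != 0) &
          Omega `&` U = [set x | U x /\ rho x < 0]].

Definition bounded_smooth_domain Omega : Prop :=
  [/\ open Omega, connected Omega, Omega !=set0, bounded_set Omega &
      smooth_boundary Omega].

Definition laplacian f : 'rV[R]_d -> R :=
  fun x => \sum_(j < d) partial j (partial j f) x.

(* R[i] is not a normed R-space in the library, so limits of complex-valued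
   functions of x : R^d are taken on real and imaginary parts. *)
Definition re_part g : 'rV[R]_d -> R := fun x => complex.Re (g x).
Definition im_part g : 'rV[R]_d -> R := fun x => complex.Im (g x).

Definition cpartial j g : 'rV[R]_d -> R[i] :=
  fun x => (partial j (re_part g) x +i* partial j (im_part g) x)%C.

Definition cderivable g x j : Prop :=
  derivable (re_part g) x (basis_vec j) /\
  derivable (im_part g) x (basis_vec j).

Definition ccontinuous_on (D : set 'rV[R]_d) g : Prop :=
  {within D, continuous (re_part g)} /\ {within D, continuous (im_part g)}.

(* The j-th component - i d/dx_j - A_j of the operator - i grad - A. *)
Definition momentum A j g : 'rV[R]_d -> R[i] :=
  fun x => - 'i%C * cpartial j g x - (A x 0 j)%:C%C * g x.

(* (- i grad - A)^2 = \sum_j (- i d/dx_j - A_j)^2. *)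
Definition magnetic_sq A g : 'rV[R]_d -> R[i] :=
  fun x => \sum_(j < d) momentum A j (momentum A j g) x.

(* Classical solution, continuous up to the boundary, of
   (1/2 (- i grad - A)^2 + V) phi = lambda phi in Omega, phi = 0 on the
   boundary.  Since 'D_v is total, the existence of the derivatives occurring
   in the equation is required separately; functions that are C^2 in Omega
   satisfy this requirement.  The values of phi outside closure Omega are
   irrelevant. *)
Definition magnetic_dirichlet_eigenfunction
    Omega A V (lambda : R) phi : Prop :=
  [/\ ccontinuous_on (closure Omega) phi,
      (forall x j, Omega x ->
         cderivable phi x j /\ cderivable (momentum A j phi) x j),
      (forall x, Omega x ->
         2^-1 * magnetic_sq A phi x + (V x)%:C%C * phi x =
         lambda%:C%C * phi x),
      (forall x, frontier Omega x -> phi x = 0) &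
      (exists x, Omega x /\ phi x != 0)].

(* Classical solution of (- 1/2 Delta + V) u = 1 in Omega, u = 0 on the
   boundary, in the same sense. *)
Definition landscape_function Omega V u : Prop :=
  [/\ {within closure Omega, continuous u},
      (forall x j, Omega x ->
         derivable u x (basis_vec j) /\
         derivable (partial j u) x (basis_vec j)),
      (forall x, Omega x -> - (2^-1 * laplacian u x) + V x * u x = 1) &
      (forall x, frontier Omega x -> u x = 0)].

Definition box (a b : 'rV[R]_d) : set 'rV[R]_d :=
  [set x | forall j, a 0 j <= x 0 j <= b 0 j].

Definition box_volume (a b : 'rV[R]_d) : R := \prod_(j < d) (b 0 j - a 0 j).

(* Null sets of d-dimensional Lebesgue measure, i.e. sets of outer measure 0:
   the library has Lebesgue measure on R only. *)
Definition lebesgue_null N : Prop :=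
  forall eps : R, 0 < eps ->
    exists a b : nat -> 'rV[R]_d,
      [/\ (forall k j, a k 0 j <= b k 0 j),
          N `<=` \bigcup_k box (a k) (b k) &
          (\sum_(0 <= k <oo) (box_volume (a k) (b k))%:E <= eps%:E)%E].

(* Essential supremum of |g| over Omega.  As inf is total, this is the L^oo
   norm only when g is essentially bounded on Omega (g is continuous on the
   compact set closure Omega below). *)
Definition Linfty_norm Omega g : R :=
  inf [set M : R | 0 <= M /\
                   lebesgue_null [set x | Omega x /\ M < Normc.normc (g x)]].

End Defs.

(* Main.v *)
Require Import Defs.
From mathcomp Require Import all_boot all_order all_algebra.
From mathcomp Require Import all_classical all_reals all_analysis.
From mathcomp Require Import measurable_realfun ring lra.
Import Order.TTheory GRing.Theory Num.Theory.
Import numFieldNormedType.Exports.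
Local Open Scope classical_set_scope.
Local Open Scope ring_scope.

Set Implicit Arguments.
Unset Strict Implicit.

(** Write [M] for the essential supremum of [|phi|].  The statement is a
maximum principle for [|phi| - K u]: if the constant [K] exceeds
[lambda |phi|] everywhere, then [|phi| <= K u].  Letting [K] decrease to
[lambda M] gives the theorem.  Working with a strict inequality for [K]
removes the need for the perturbation (by a multiple of [|x|^2], say) with
which one usually makes a weak maximum principle strict.

Suppose that [|phi| - K u] has a positive maximum [m], attained at [c].  The
boundary conditions put [c] inside [Omega].  There [q = K u + m] touches
[|phi|] from above, so [|phi|^2 - q^2] has a local maximum at [c], and its pure
second derivatives are nonpositive.  This uses neither the smoothness of
[|phi|] nor any regularity beyond the existence of second derivatives along
the axes.  For the magnetic derivative [P = (- i d/dx_j - A_j) phi] one has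
[(|phi|^2)' = 2 Re (conj phi i P)], where the real potential [A_j] cancels, and
likewise
[(|phi|^2)'' = 2 |P|^2 - 2 Re (conj phi (- i d/dx_j - A_j) P)].
Since the first derivative of [|phi|^2 - q^2] vanishes at [c], the
Cauchy-Schwarz inequality gives [q' ^ 2 <= |P|^2] (the diamagnetic inequality),
and the second derivative test reduces to
[- Re (conj phi (- i d/dx_j - A_j)^2 phi) <= q q'']
([re_momentum_sq_le_touching]).  Summing over [j] and inserting the two
equations yields [V m + (K - lambda |phi(c)|) <= 0], which is impossible
([eigenfunction_le_landscape]).  When [phi(c) = 0] the division by [q(c)] is
not available, but then [q] itself has a local minimum at [c], which
contradicts the equation for [u].

The same comparison shows [lambda >= 0]: for negative [lambda] every [K > 0]
is admissible, and [K] tending to [0] would force [phi = 0].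

It remains to see that [|phi| <= M] holds at every point.  As [phi] is
continuous, this amounts to the fact that a nonempty open set is not a null
set ([nbhs_not_lebesgue_null]), that is, that countably many boxes covering a
cube have total volume at least that of the cube ([box_cover_volume]).  This is
obtained from Lebesgue measure on the line, one coordinate after the
other. *)

(** * Second derivative test along a direction *)

Lemma is_derive_line (R : realType) (W : normedModType R) (h : W -> R)
    (x v : W) (t df : R) :
  is_derive (x + t *: v) v h df ->
  is_derive t (1 : R) (fun s : R => h (x + s *: v)) df.
Proof.
move=> [dh Dh].
have E : (fun k : R => k^-1 *: (((fun s : R => h (x + s *: v)) \o shift t)
              (k *: 1) - h (x + t *: v))) =
         (fun k : R => k^-1 *: ((h \o shift (x + t *: v)) (k *: v)
              - h (x + t *: v))).
  apply/funext => k /=; congr (_ *: (h _ - _)).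
  rewrite scalerDl addrA [in RHS]addrCA -addrA; congr (_ + (_ + _)).
  by rewrite /GRing.scale /= mulr1.
split; first by rewrite /derivable E; exact: dh.
by rewrite /derive E.
Qed.

(** If [f2] were positive, [f1] would be positive on the right of [0], and by
the mean value theorem [f] would exceed its maximum there.  The derivative is
carried by the separate function [f1], so that callers may supply a closed
expression valid only near the point. *)
Lemma real_second_derivative_test (R : realType) (f f1 : R -> R) (f2 : R) :
  (\forall t \near (0 : R), is_derive t (1 : R) f (f1 t)) ->
  is_derive (0 : R) (1 : R) f1 f2 ->
  (\forall t \near (0 : R), f t <= f 0) ->
  f1 0 = 0 /\ f2 <= 0.
Proof.
move=> df [df1 Df1] fmax.
have /nbhs_ballP [e /= e0 He] :
  \forall t \near (0 : R), is_derive t (1 : R) f (f1 t) /\ f t <= f 0.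
  by near do split.
have {}He (t : R) : `|t| < e -> is_derive t (1 : R) f (f1 t) /\ f t <= f 0.
  by move=> te; apply: He; rewrite /ball/= sub0r normrN.
have in_ball (t : R) : t \in `]- e, e[ -> `|t| < e.
  by rewrite in_itv/= ltr_norml.
have f10 : f1 0 = 0.
  have [||||_ Ef] := @derive1_at_max R f (- e) e 0.
  - by lra.
  - by move=> t /in_ball /He[[]].
  - by rewrite in_itv/= oppr_lt0 e0.
  - by move=> t /in_ball /He[].
  by have [|[_ <-]] := He 0; rewrite ?normr0.
split=> //; rewrite leNgt; apply/negP => f2_gt0.
have /cvgr_gt/(_ _ f2_gt0) :
    (fun k : R => k^-1 *: ((f1 \o shift 0) (k *: 1) - f1 0)) @ 0^' --> f2.
  by rewrite -Df1; exact: df1.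
move=> /nbhs_ballP[e' /= e'0 He'].
pose b := Num.min e e' / 2.
have [b0 be be'] : [/\ 0 < b, b < e & b < e'].
  have : Num.min e e' <= e by rewrite ge_min lexx.
  have : Num.min e e' <= e' by rewrite ge_min lexx orbT.
  have : 0 < Num.min e e' by rewrite lt_min e0.
  by rewrite /b => *; split; lra.
have [||c cb Ec] := @MVT R f f1 0 b b0.
- move=> t; rewrite in_itv/= => /andP[t0 tb].
  by have [|] := He t; rewrite ?gtr0_norm//; lra.
- apply: derivable_within_continuous => t; rewrite in_itv/= => /andP[t0 tb].
  by have [|[]] := He t; rewrite ?ger0_norm//; lra.
move: cb; rewrite in_itv/= => /andP[c0 cb].
have : 0 < f1 c.
  have := He' c; rewrite /ball/= sub0r normrN gtr0_norm// f10 subr0 addr0.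
  rewrite /GRing.scale/= mulr1 => /(_ ltac:(lra)).
  by move=> /(_ (lt0r_neq0 c0)); rewrite pmulr_rgt0 ?invr_gt0.
move=> f1c; have [|_] := He b; first by rewrite gtr0_norm.
by rewrite leNgt -subr_gt0 Ec subr0 mulr_gt0.
Unshelve. all: by end_near. Qed.

Lemma near_line (R : realType) (W : normedModType R) (x v : W) (P : W -> Prop) :
  (\forall y \near x, P y) -> \forall t \near (0 : R), P (x + t *: v).
Proof.
move=> Px; have : (fun t : R => x + t *: v) t @[t --> (0 : R)] --> x.
  rewrite -[X in _ --> X](addr0 x) -(scale0r v).
  by apply: cvgD; [exact: cvg_cst|apply: cvgZ; [exact: cvg_id|exact: cvg_cst]].
by move=> xP; exact: (xP P Px).
Qed.

Lemma second_derivative_test (R : realType) (W : normedModType R)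
    (h h1 : W -> R) (x v : W) (h2 : R) :
  (\forall y \near x, is_derive y v h (h1 y)) ->
  is_derive x v h1 h2 ->
  (\forall y \near x, h y <= h x) ->
  h1 x = 0 /\ h2 <= 0.
Proof.
move=> dh dh1 hmax.
have x0 : x + (0 : R) *: v = x by rewrite scale0r addr0.
have [|||h10 h20] := @real_second_derivative_test R
  (fun t => h (x + t *: v)) (fun t => h1 (x + t *: v)) h2.
- near=> t; apply: is_derive_line; near: t.
  exact: (@near_line R W x v (fun y => is_derive y v h (h1 y))).
- by apply: is_derive_line; rewrite x0.
- by rewrite x0; exact: (@near_line R W x v (fun y => h y <= h x)).
- by rewrite x0 in h10.
Unshelve. all: by end_near. Qed.

(** * Magnetic derivatives of a function touched from above *)

Lemma re_momentum (R : realType) (d : nat) (A : 'rV[R]_d -> 'rV[R]_d) (j : 'I_d)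
    (g : 'rV[R]_d -> R[i]) (x : 'rV[R]_d) :
  re_part (momentum A j g) x =
  partial j (im_part g) x - A x 0 j * re_part g x.
Proof.
rewrite /momentum /cpartial /re_part /im_part.
by case: (g x) => a b; simpc => /=; ring.
Qed.

Lemma im_momentum (R : realType) (d : nat) (A : 'rV[R]_d -> 'rV[R]_d) (j : 'I_d)
    (g : 'rV[R]_d -> R[i]) (x : 'rV[R]_d) :
  im_part (momentum A j g) x =
  - partial j (re_part g) x - A x 0 j * im_part g x.
Proof.
rewrite /momentum /cpartial /re_part /im_part.
by case: (g x) => a b; simpc => /=; ring.
Qed.

Lemma normc_sqr (R : realType) (z : R[i]) :
  Normc.normc z ^+ 2 = complex.Re z ^+ 2 + complex.Im z ^+ 2.
Proof. by case: z => a b; rewrite /= sqr_sqrtr// addr_ge0// sqr_ge0. Qed.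

(** The real form of the touching inequality.  Here [r], [s] are the real and
imaginary parts of a function [f], [a] is a component of the vector potential,
and [p1], [p2] are the parts of [P = - i f' - a f].  The derivatives of [r] and
[s] are eliminated in favour of [p1] and [p2]: then [a] drops out of the first
derivative of [r^2 + s^2 - q^2], so that [a] need not be differentiable. *)
Lemma sq_touching_second_derivative (R : realType) (W : normedModType R)
    (v x : W) (r s q r1 s1 q1 a p1 p2 : W -> R) (dp1 dp2 q2 : R) :
  (\forall y \near x, [/\ is_derive y v r (r1 y), is_derive y v s (s1 y) &
                          is_derive y v q (q1 y)]) ->
  (forall y, p1 y = s1 y - a y * r y) ->
  (forall y, p2 y = - r1 y - a y * s y) ->
  is_derive x v p1 dp1 -> is_derive x v p2 dp2 -> is_derive x v q1 q2 ->
  (\forall y \near x, r y ^+ 2 + s y ^+ 2 <= q y ^+ 2) ->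
  r x ^+ 2 + s x ^+ 2 = q x ^+ 2 -> 0 < q x ->
  - (r x * (dp2 - a x * p1 x) + s x * (- dp1 - a x * p2 x)) <= q x * q2.
Proof.
move=> drsq p1E p2E Dp1 Dp2 Dq1 le_q eq_q qx0.
pose h y : R := r y * r y + s y * s y - q y * q y.
pose h1 y : R := 2 * (s y * p1 y - r y * p2 y - q y * q1 y).
pose h2 : R := 2 * (p1 x ^+ 2 + p2 x ^+ 2
  - (r x * (dp2 - a x * p1 x) + s x * (- dp1 - a x * p2 x))
  - q1 x ^+ 2 - q x * q2).
have [||| hx1 hx2] := @second_derivative_test R W h h1 x v h2.
- near=> y.
  have [dr ds dq] : [/\ is_derive y v r (r1 y), is_derive y v s (s1 y) &
                        is_derive y v q (q1 y)] by near: y.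
  apply: (is_derive_eq (is_deriveB (is_deriveD (is_deriveM dr dr)
           (is_deriveM ds ds)) (is_deriveM dq dq))).
  rewrite /h1 p1E p2E /GRing.scale/=; ring.
- have [dr ds dq] := nbhs_singleton drsq.
  apply: (is_derive_eq (is_deriveZ 2 (is_deriveB (is_deriveB (is_deriveM ds Dp1)
           (is_deriveM dr Dp2)) (is_deriveM dq Dq1)))).
  have -> : s1 x = p1 x + a x * r x by rewrite p1E; ring.
  have -> : r1 x = - p2 x - a x * s x by rewrite p2E; ring.
  rewrite /h2 /GRing.scale/=; ring.
- near=> y.
  have : r y ^+ 2 + s y ^+ 2 <= q y ^+ 2 by near: y.
  by rewrite /h -!expr2 eq_q subrr subr_le0.
have qq1 : q x * q1 x = s x * p1 x - r x * p2 x by move: hx1; rewrite /h1; lra.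
(* Cauchy-Schwarz, in the form of the Lagrange identity for (s, - r) and
   (p1, p2) *)
have : (q x * q1 x) ^+ 2 <= q x ^+ 2 * (p1 x ^+ 2 + p2 x ^+ 2).
  rewrite qq1 -eq_q -subr_ge0; set t := (X in 0 <= X).
  suff -> : t = (r x * p1 x + s x * p2 x) ^+ 2 by exact: sqr_ge0.
  by rewrite /t; ring.
rewrite exprMn ler_pM2l ?exprn_gt0// => CS.
by move: hx2; rewrite /h2; lra.
Unshelve. all: by end_near. Qed.

(** Replaces the touching inequality at a zero of [phi], where the touching
function attains its minimum. *)
Lemma min_second_derivative_ge0 (R : realType) (W : normedModType R)
    (v x : W) (q q1 : W -> R) (q2 : R) :
  (\forall y \near x, is_derive y v q (q1 y)) ->
  is_derive x v q1 q2 ->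
  (\forall y \near x, q x <= q y) -> 0 <= q2.
Proof.
move=> dq dq1 q_min.
have [|| _] := @second_derivative_test R W (fun y => - q y)
  (fun y => - q1 y) x v (- q2).
- near=> y; have dqy : is_derive y v q (q1 y) by near: y.
  exact: is_deriveN dqy.
- by near=> y; rewrite lerN2; near: y.
by rewrite oppr_le0.
Unshelve. all: by end_near. Qed.

(** The inequality used on each coordinate axis; [Re (conj phi P P phi)]
expands into the real combination of [sq_touching_second_derivative]. *)
Lemma re_momentum_sq_le_touching (R : realType) (d : nat)
    (A : 'rV[R]_d -> 'rV[R]_d) (j : 'I_d) (phi : 'rV[R]_d -> R[i])
    (q q1 : 'rV[R]_d -> R) (q2 : R) (x : 'rV[R]_d) :
  (\forall y \near x, cderivable phi y j) ->
  cderivable (momentum A j phi) x j ->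
  (\forall y \near x, is_derive y (basis_vec j) q (q1 y)) ->
  is_derive x (basis_vec j) q1 q2 ->
  (\forall y \near x, Normc.normc (phi y) <= q y) ->
  Normc.normc (phi x) = q x -> 0 < q x ->
  - complex.Re ((phi x)^*%C * momentum A j (momentum A j phi) x)
    <= q x * q2.
Proof.
move=> dphi [dP1 dP2] dq dq1 phi_le phiq qx0.
set P := momentum A j phi in dP1 dP2 *.
have -> : complex.Re ((phi x)^*%C * momentum A j P x) =
   re_part phi x * (partial j (im_part P) x - A x 0 j * re_part P x) +
   im_part phi x * (- partial j (re_part P) x - A x 0 j * im_part P x).
  rewrite -re_momentum -im_momentum /re_part /im_part.
  by case: (phi x) (momentum A j P x) => a b [e f] /=; ring.
apply: (@sq_touching_second_derivative R _ (basis_vec j) x _ _ q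
  (partial j (re_part phi)) (partial j (im_part phi)) q1
  (fun y => A y 0 j) (re_part P) (im_part P)
  (partial j (re_part P) x) (partial j (im_part P) x)
  q2) => //.
- near=> y.
  have [dr ds] : cderivable phi y j by near: y.
  have dqy : is_derive y (basis_vec j) q (q1 y) by near: y.
  by split; [exact: (derivableP dr)|exact: (derivableP ds)|].
- exact: re_momentum.
- exact: im_momentum.
- near=> y.
  have le_q : Normc.normc (phi y) <= q y by near: y.
  have n0 : 0 <= Normc.normc (phi y) by case: (phi y) => *; exact: sqrtr_ge0.
  by rewrite -normc_sqr lerXn2r ?nnegrE ?(le_trans n0 le_q).
- by rewrite -normc_sqr phiq.
Unshelve. all: by end_near. Qed.

(** * Nonempty open sets are not null *)

(** Induction on the list [s] of coordinates already integrated.  For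
[s = [::]] the claim says that each point of the cube lies in some box, and for
[s] the whole index set it compares the volumes.  To pass from [s] to
[i :: s], integrate the inequality at [x] over the [i]-th coordinate in
[[p i, q i]]: the left-hand side is multiplied by [q i - p i], and in the
[k]-th summand the indicator of [[a k i, b k i]] is replaced by at most
[b k i - a k i]. *)
Lemma box_cover_volume (R : realType) (d : nat) (p q : 'I_d -> R)
    (a b : nat -> 'I_d -> R) :
  (forall j, p j <= q j) -> (forall k j, a k j <= b k j) ->
  (forall x : 'I_d -> R, (forall j, p j <= x j <= q j) ->
     exists k, forall j, a k j <= x j <= b k j) ->
  ((\prod_(j < d) (q j - p j))%:E <=
     \sum_(0 <= k <oo) (\prod_(j < d) (b k j - a k j))%:E)%E.
Proof.
move=> le_pq le_ab cover.
pose c k j (y : R) := (y \in `[a k j, b k j])%:R : R.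
(* The contribution of coordinate j to the k-th box: its side length once j
   is integrated, and before that the indicator of its side. *)
pose w (s : seq 'I_d) k (x : 'I_d -> R) j :=
  if j \in s then b k j - a k j else c k j (x j).
have w_ge0 s k x j : 0 <= w s k x j.
  by rewrite /w; case: ifP => _; rewrite ?subr_ge0 // /c ler0n.
suff main (s : seq 'I_d) : uniq s ->
    forall x : 'I_d -> R, (forall j, p j <= x j <= q j) ->
    ((\prod_(j <- s) (q j - p j))%:E <=
       \sum_(0 <= k <oo) (\prod_(j < d) w s k x j)%:E)%E.
  have := main (enum 'I_d) (enum_uniq _) p.
  rewrite big_enum => /(_ _)/le_trans; apply=> [j|].
    by rewrite lexx le_pq.
  apply: lee_nneseries => k *.
    by rewrite lee_fin prodr_ge0.
  by rewrite lee_fin; under eq_bigr do rewrite /w mem_enum.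
elim: s => [_ x xpq|i s IH /= /andP[i_s us] x xpq].
  have [k xk] := cover x xpq.
  rewrite big_nil; apply: (@le_trans _ _
    (\sum_(0 <= l < k.+1) (\prod_(j < d) w [::] l x j)%:E)%E).
    rewrite big_nat_recr//= [X in (_ + X%:E)%E]big1; last first.
      by move=> j _; rewrite /w/= /c in_itv/= xk.
    by rewrite leeDr // sume_ge0// => l _; rewrite lee_fin prodr_ge0.
  by apply: nneseries_lim_ge => l _ _; rewrite lee_fin prodr_ge0.
pose G k := \prod_(j < d | j != i) w s k x j.
have G_ge0 k : 0 <= G k by rewrite prodr_ge0.
pose C := \prod_(j <- s) (q j - p j).
(* As i is not in s, only the i-th factor of the product depends on t. *)
pose xt (t : R) j := if j == i then t else x j.
have prodE k t : \prod_(j < d) w s k (xt t) j = G k * c k i t.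
  rewrite (bigD1 i)//= mulrC; congr (_ * _).
    by apply: eq_bigr => j /negbTE ji; rewrite /w /xt ji.
  by rewrite /w (negbTE i_s) /xt eqxx.
have cE k : (fun t : measurableTypeR R => (c k i t)%:E) =
    (fun t : measurableTypeR R => (\1_`[a k i, b k i] t)%:E).
  by apply/funext => t /=; rewrite indicE mem_setE.
have mc (k : nat) : measurable_fun
    (`[p i, q i]%classic : set (measurableTypeR R))
    ((fun t => (c k i t)%:E) : measurableTypeR R -> \bar R).
  by rewrite cE; apply/measurable_EFinP; exact: measurable_indic.
have : (\int[lebesgue_measure]_(t in `[p i, q i]) (cst C%:E t)
      <= \int[lebesgue_measure]_(t in `[p i, q i])
           \sum_(0 <= k <oo) ((G k)%:E * (c k i t)%:E))%E.
  apply: ge0_le_integral => //.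
  - move=> t _; rewrite lee_fin prodr_ge0// => j _; by rewrite subr_ge0.
  - apply: ge0_emeasurable_sum => //.
      by move=> k t _ _; rewrite mule_ge0// lee_fin ?ler0n.
    by move=> k _; apply: measurable_funeM; exact: mc.
  - move=> t; rewrite /= in_itv/= => tpq.
    have := IH us (xt t) _; under eq_eseriesr do rewrite prodE EFinM.
    by apply=> j; rewrite /xt; case: eqP => // ->.
rewrite integral_cst// integral_nneseries//; first last.
- by move=> k t _; rewrite mule_ge0// lee_fin ?ler0n.
- by move=> k; apply: measurable_funeM; exact: mc.
have len_itv (e f : R) : e <= f ->
    (if e < f then (f%:E - e%:E)%E else 0%E) = (f - e)%:E.
  by rewrite le_eqVlt => /predU1P[->|->//]; rewrite ltxx subrr.
rewrite /= lebesgue_measure_itv/= lte_fin len_itv//.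
rewrite big_cons mulrC -EFinM => /le_trans; apply.
apply: lee_nneseries => k *.
  apply: integral_ge0 => t _; by rewrite mule_ge0// lee_fin ?ler0n.
rewrite ge0_integralZl//; last 2 first.
- by move=> t _; rewrite lee_fin ler0n.
- by rewrite lee_fin.
rewrite (bigD1 i)//= {1}/w mem_head mulrC EFinM.
have -> : \prod_(j < d | j != i) w (i :: s) k x j = G k.
  by apply: eq_bigr => j /negbTE ji; rewrite /w in_cons ji.
apply: lee_wpmul2l; first by rewrite lee_fin.
rewrite (_ : (fun t => _) = (fun t => (\1_`[a k i, b k i] t)%:E)); last first.
  exact: cE.
rewrite integral_indic// /= -(len_itv _ _ (le_ab k i)) -lte_fin.
rewrite -(lebesgue_measure_itv `[a k i, b k i]).
by apply: le_measure; rewrite ?inE//; exact: measurableI.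
Qed.

(** A neighbourhood contains a cube of side [e]; a cover of total volume at most
[e ^ d / 2] contradicts [box_cover_volume]. *)
Lemma nbhs_not_lebesgue_null (R : realType) (d : nat) (x : 'rV[R]_d)
    (N : set 'rV[R]_d) : nbhs x N -> ~ lebesgue_null N.
Proof.
move=> /nbhs_ballP[e /= e0 ballN] /(_ ((e ^+ d) / 2)) [|a [b [le_ab Nab]]].
  by rewrite divr_gt0// exprn_gt0.
apply/negP; rewrite -ltNge.
have := @box_cover_volume R d (fun j => x 0 j - e / 2) (fun j => x 0 j + e / 2)
  (fun k j => a k 0 j) (fun k j => b k 0 j).
move=> /(_ _ le_ab) H; apply: lt_le_trans (H _ _).
- rewrite lte_fin (eq_bigr (fun=> e)) => [|j _]; last by lra.
  rewrite prodr_const card_ord; have := exprn_gt0 d e0; lra.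
- by move=> j; lra.
- move=> y yQ; have : N (\row_j y j).
    apply: ballN; split=> // i j; rewrite (ord1 i) /ball/= mxE ltr_norml.
    by have := yQ j; lra.
  move=> /Nab[k _ kb]; exists k => j.
  by have := kb j; rewrite mxE.
Qed.

(** * The maximum principle *)

Lemma compact_closure_bounded (R : realType) (d : nat) (D : set 'rV[R]_d) :
  bounded_set D -> compact (closure D).
Proof.
move=> [M [_ DM]]; apply: bounded_closed_compact; last exact: closed_closure.
pose B : set 'rV[R]_d := [set x | `|x| <= M + 1].
have closedB : closed B.
  have : closed ((fun x : 'rV[R]_d => `|x|) @^-1` [set r : R | r <= M + 1]).
    by apply: closed_comp => [x _|]; [exact: norm_continuous|exact: closed_le].
  by [].
exists (M + 1); split; first exact: num_real.
move=> r Mr x; rewrite closureE => /(_ B) Bx; apply: le_trans (ltW Mr).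
by apply: Bx; split=> // y Dy; apply: DM => //; rewrite ltrDl.
Qed.

Lemma normc_ge0 (R : realType) (z : R[i]) : 0 <= Normc.normc z.
Proof. by case: z => *; exact: sqrtr_ge0. Qed.

Lemma within_continuous_normc (R : realType) (d : nat) (D : set 'rV[R]_d)
    (phi : 'rV[R]_d -> R[i]) :
  ccontinuous_on D phi ->
  {within D, continuous (fun x => Normc.normc (phi x))}.
Proof.
move=> [cre cim].
pose g x := re_part phi x * re_part phi x + im_part phi x * im_part phi x.
have -> : (fun x => Normc.normc (phi x)) = (fun x => Num.sqrt (g x)).
  apply/funext => x.
  by rewrite /g -!expr2 -normc_sqr sqrtr_sqr ger0_norm ?normc_ge0.
have cg : {within D, continuous g}.
  by move=> x; apply: cvgD; apply: cvgM; by [exact: cre|exact: cim].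
move=> x.
by have := @cvg_comp _ _ _ g Num.sqrt _ _ _ (cg x) (@sqrt_continuous R (g x)).
Qed.

Lemma eigen_re_magnetic_sq (R : realType) (z w : R[i]) (V lambda : R) :
  2^-1 * w + V%:C%C * z = lambda%:C%C * z ->
  complex.Re (z^*%C * w) = 2 * (lambda - V) * Normc.normc z ^+ 2.
Proof.
move=> E.
have -> : w = (2 * (lambda - V))%:C%C * z.
  have -> : w = 2 * (2^-1 * w + V%:C%C * z) - (2 * V)%:C%C * z.
    have -> : (2 * V)%:C%C = 2 * V%:C%C :> R[i] by rewrite rmorphM rmorph_nat.
    by field.
  by rewrite E !rmorphM rmorphB rmorph_nat; ring.
by rewrite normc_sqr; case: z {E} => a b; simpc => /=; ring.
Qed.

(** The comparison [|phi| <= K u] for a supersolution [K u]: at a positive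
maximum of the difference, [- 1/2 Delta (K u) + V K u = K] beats
[lambda |phi|]. *)
Lemma eigenfunction_le_landscape (R : realType) (d : nat)
    (Omega : set 'rV[R]_d) (A : 'rV[R]_d -> 'rV[R]_d) (V : 'rV[R]_d -> R)
    (lambda K : R) (phi : 'rV[R]_d -> R[i]) (u : 'rV[R]_d -> R) :
  open Omega -> bounded_set Omega -> (forall x, 0 <= V x) ->
  magnetic_dirichlet_eigenfunction Omega A V lambda phi ->
  landscape_function Omega V u ->
  (forall x, Omega x -> lambda * Normc.normc (phi x) < K) ->
  forall x, Omega x -> Normc.normc (phi x) <= K * u x.
Proof.
move=> openO bO V0 [cphi dphi ephi phi0 _] [cu du eu u0] ltK x Ox.
rewrite leNgt; apply/negP => lt_x.
pose f y := Normc.normc (phi y) - K * u y.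
have cf : {within closure Omega, continuous f}.
  move=> y; apply: cvgB; first exact: within_continuous_normc.
  by apply: cvgM; [exact: cvg_cst|exact: cu].
have clOx : closure Omega x by exact: subset_closure.
have [c clc fmax] : exists2 c, c \in closure Omega &
    forall y, y \in closure Omega -> f y <= f c.
  apply: EVT_max_rV cf; last exact: compact_closure_bounded.
  by exists x.
pose m := f c.
have m0 : 0 < m.
  have := fmax x; rewrite inE => /(_ clOx); apply: lt_le_trans.
  by rewrite subr_gt0.
have Oc : Omega c.
  apply: contrapT => nOc; have fc : frontier Omega c.
    by split; [rewrite inE in clc|move=> /interior_subset].
  by move: m0; rewrite /m /f phi0// u0// Normc.normc0 mulr0 subrr ltxx.
have nearO : \forall y \near c, Omega y by exact: open_nbhs_nbhs.
pose q y := K * u y + m.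
have le_q y : Omega y -> Normc.normc (phi y) <= q y.
  move=> Oy; rewrite -lerBlDl; apply: fmax.
  by rewrite inE; exact: subset_closure.
have qc : Normc.normc (phi c) = q c by rewrite /q /m /f addrC subrK.
have dq j : \forall y \near c,
    is_derive y (basis_vec j) q (K * partial j u y).
  near=> y; have [|dy _] := du y j; first by near: y.
  have /(is_deriveZ K) D := derivableP dy.
  by apply: (is_derive_eq (is_deriveD D (is_derive_cst m _ _))); rewrite addr0.
have dq1 j : is_derive c (basis_vec j) (fun y => K * partial j u y)
    (K * partial j (partial j u) c).
  by have [_ /derivableP/(is_deriveZ K)] := du c j Oc.
have lapu : laplacian u c = 2 * (V c * u c - 1) by have := eu c Oc; lra.
(* Where phi vanishes, q has a minimum, so that laplacian u c >= 0, while
   u c < 0 makes it negative. *)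
have := normc_ge0 (phi c); rewrite le_eqVlt => /predU1P[phic0|phic_gt0].
  have : 0 <= K * laplacian u c.
    rewrite mulr_sumr sumr_ge0// => j _.
    apply: (min_second_derivative_ge0 (dq j) (dq1 j)); near=> y.
    by rewrite -qc -phic0 (le_trans (normc_ge0 (phi y)))// le_q//; near: y.
  have K0 : 0 < K by have := ltK c Oc; rewrite -phic0 mulr0.
  rewrite pmulr_rge0// lapu => Vu1.
  have uc : u c < 0.
    by rewrite -(pmulr_rlt0 _ K0); move: qc; rewrite -phic0 /q; lra.
  have : V c * u c <= 0 by rewrite mulr_ge0_le0// ltW.
  lra.
have : - complex.Re ((phi c)^*%C * magnetic_sq A phi c)
    <= q c * (K * laplacian u c).
  have ReD : {morph @complex.Re R : z w / z + w} by case=> ? ? [].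
  have Re0 : complex.Re 0 = 0 :> R by [].
  rewrite /magnetic_sq mulr_sumr (big_morph _ ReD Re0).
  rewrite -sumrN /laplacian !mulr_sumr; apply: ler_sum => j _.
  apply: (re_momentum_sq_le_touching _ _ (dq j) (dq1 j)) => //.
  - by near=> y; have [|//] := dphi y j; first by near: y.
  - by have [_] := dphi c j Oc.
  - by near=> y; apply: le_q; near: y.
  - by rewrite -qc.
rewrite (eigen_re_magnetic_sq (ephi c Oc)) lapu -qc.
set t := Normc.normc (phi c) in phic_gt0 qc *.
have -> : - (2 * (lambda - V c) * t ^+ 2) = t * (- (2 * (lambda - V c) * t)).
  by ring.
rewrite ler_pM2l// => le_t.
have : 0 <= V c * m by rewrite mulr_ge0// ltW.
have -> : m = t - K * u c by [].
have := ltK c Oc; rewrite -/t; nra.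
Unshelve. all: by end_near. Qed.

(** The maximum of [|phi|] over the compact closure is an admissible bound, so
the infimum defining the norm is over a nonempty set; every admissible bound is
a pointwise one, since otherwise [|phi|] would exceed it on a
neighbourhood. *)
Lemma normc_le_Linfty_norm (R : realType) (d : nat) (Omega : set 'rV[R]_d)
    (phi : 'rV[R]_d -> R[i]) : (0 < d)%N ->
  open Omega -> bounded_set Omega -> ccontinuous_on (closure Omega) phi ->
  forall x, Omega x -> Normc.normc (phi x) <= Linfty_norm Omega phi.
Proof.
move=> d0 openO bO cphi x Ox.
have cn := within_continuous_normc cphi.
apply: lb_le_inf.
  have clOx : closure Omega x by exact: subset_closure.
  have [c _ cmax] :=
    EVT_max_rV (ex_intro _ x clOx) (compact_closure_bounded bO) cn.
  exists (Normc.normc (phi c)); split; first exact: normc_ge0.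
  (* The exceptional set is empty; it is covered by boxes reduced to the
     origin, of volume 0 because d > 0. *)
  move=> eps eps0; exists (fun=> 0), (fun=> 0); split=> // [y [Oy]|].
    by rewrite ltNge cmax// inE; exact: subset_closure.
  rewrite eseries0 ?lee_fin ?ltW// => k _ _.
  rewrite /box_volume; under eq_bigr do rewrite subrr.
  by rewrite prodr_const card_ord expr0n gtn_eqF.
move=> M [_ nullM]; rewrite leNgt; apply/negP => ltM.
apply: (@nbhs_not_lebesgue_null R d x _ _ nullM).
have : {in Omega, continuous (fun x => Normc.normc (phi x))}.
  rewrite -continuous_open_subspace//.
  by apply: continuous_subspaceW cn; exact: subset_closure.
move=> /(_ x); rewrite inE => /(_ Ox)/cvgr_gt/(_ _ ltM) nearM.
have nearO : \forall y \near x, Omega y by exact: open_nbhs_nbhs.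
by near=> y; split; near: y.
Unshelve. all: by end_near. Qed.

(** * Comparison of eigenfunctions with the landscape function *)

Unset Implicit Arguments.

Theorem theorem1 (R : realType) (d : nat) (hd : (0 < d)%N)
  (Omega : set 'rV[R]_d) (hOmega : bounded_smooth_domain Omega)
  (A : 'rV[R]_d -> 'rV[R]_d) (hA : C1_field A)
  (V : 'rV[R]_d -> R) (hV : Ck 1 setT V) (hV0 : forall x, 0 <= V x)
  (lambda : R) (phi : 'rV[R]_d -> R[i])
  (hphi : magnetic_dirichlet_eigenfunction Omega A V lambda phi)
  (u : 'rV[R]_d -> R) (hu : landscape_function Omega V u) :
  forall x, Omega x ->
    Normc.normc (phi x) / Linfty_norm Omega phi <= lambda * u x.
Proof.
move=> x Ox; have [openO _ _ bO _] := hOmega.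
have le_K := eigenfunction_le_landscape openO bO hV0 hphi hu.
have [cphi _ _ _ [z [Oz phiz]]] := hphi.
set M := Linfty_norm Omega phi.
have le_M y : Omega y -> Normc.normc (phi y) <= M.
  exact: normc_le_Linfty_norm.
have normz : 0 < Normc.normc (phi z).
  rewrite lt_neqAle normc_ge0 eq_sym andbT.
  by apply: contra_neq phiz; exact: Normc.eq0_normc.
have M0 : 0 < M := lt_le_trans normz (le_M z Oz).
(* Passage to the limit: the comparison also holds for a non-strict bound. *)
have lim_K (K0 : R) y : Omega y ->
    (forall y, Omega y -> lambda * Normc.normc (phi y) <= K0) ->
    Normc.normc (phi y) <= K0 * u y.
  move=> Oy leK0; apply/ler_addgt0Pr => e e0.
  pose D := e / (1 + `|u y|).
  have u1 : 0 < 1 + `|u y| by rewrite ltr_pwDl.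
  have D0 : 0 < D by rewrite divr_gt0.
  apply: le_trans (le_K (K0 + D) _ y Oy) _.
    by move=> y' /leK0 /le_lt_trans; apply; rewrite ltrDl.
  rewrite mulrDl lerD2l /D mulrAC ler_pdivrMr// ler_pM2l//.
  by rewrite (le_trans (ler_norm _))// lerDr.
have lambda0 : 0 <= lambda.
  rewrite leNgt; apply/negP => lambda_lt0.
  have := lim_K 0 z Oz; rewrite mul0r leNgt normz => /(_ _)/negP; apply => //.
  by move=> y _; rewrite nmulr_rle0// normc_ge0.
rewrite ler_pdivrMr// mulrAC; apply: lim_K => // y Oy.
by rewrite ler_wpM2l// le_M.
Qed.
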